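(* Let $n\ge 1$ and let $G$ be a group of invertible $n\times n$ complex matrices (under matrix multiplication) which is closed under transposition, so that transposition is an involution operation on $G$. Then the set of square tables belonging to $G$, regarded as cracovians, is closed under the cracovian product and forms under it a quasigroup with right unit element $T$ (the transposing cracovian). That is: for all $A,B$ in this set, $A\cdot B$ is in this set, there are a unique $X$ and a unique $Y$ in this set with $A\cdot X=B$ and $Y\cdot A=B$, and $A\cdot T=A$.
   Context: A cracovian is a table of complex numbers $A=\{a_{kl}\}$, where the first index $k$ labels the column and the second index $l$ labels the row. The cracovian product of two cracovians with the same number of rows is the column-by-column product: the entry of $A\cdot B$ in the $k$-th column and $l$-th row is $(A\cdot B)_{kl}=\sum_i a_{ki}b_{li}$. In matrix notation, if the same tables are regarded as matrices, $A\cdot B=B^{t}A$, where $B^{t}$ is the transposed matrix and the right-hand side is the ordinary matrix product. The transposing cracovian $T$ has entries $t_{kj}=1$ if $k=j$ and $t_{kj}=0$ if $k\ne j$. A cracovian quasigroup is a set of square cracovians having cracovian inverses which forms, under the cracovian product, a quasigroup with right unit element $T$. A cracovian inverse of $A$ is a cracovian $A^{-1}$ with $A\cdot A^{-1}=T$. *)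

(* Defs.v *)
From HB Require Import structures.
From mathcomp Require Import all_boot all_order all_algebra.
From mathcomp Require Import complex.
From mathcomp Require Import classical_sets reals.

Set Implicit Arguments.
Unset Strict Implicit.
Unset Printing Implicit Defensive.

Import GRing.Theory.
Local Open Scope ring_scope.
Local Open Scope complex_scope.

(* A cracovian with q columns and p rows is the same table as a p x q matrix,
   but its entries a_{kl} carry the column index first:
   a_{kl} is the matrix entry in row l and column k. *)
Definition cracovian (R : realType) (q p : nat) : Type := 'M[R[i]]_(p, q).

Definition centry (R : realType) (q p : nat) (A : cracovian R q p)
  (k : 'I_q) (l : 'I_p) : R[i] := A l k.

Definition cracovian_of (R : realType) (q p : nat) (a : 'I_q -> 'I_p -> R[i]) :
  cracovian R q p := \matrix_(l < p, k < q) a k l.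

(* Read as matrices, cracmul A B is B^T *m A. *)
Definition cracmul (R : realType) (q r p : nat)
    (A : cracovian R q p) (B : cracovian R r p) : cracovian R q r :=
  cracovian_of (fun k l => \sum_(i < p) centry A k i * centry B l i).

Definition cracT (R : realType) (n : nat) : cracovian R n n :=
  cracovian_of (fun k j => if k == j then 1 else 0).

Record is_matrix_group (R : realType) (n : nat) (G : set 'M[R[i]]_n) : Prop := {
  matrix_group_unit : forall A, G A -> A \in unitmx;
  matrix_group1 : G 1%:M;
  matrix_groupM : forall A B, G A -> G B -> G (A *m B);
  matrix_groupV : forall A, G A -> G (invmx A)
}.

Record is_quasigroup (T : Type) (S : set T) (op : T -> T -> T) : Prop := {
  quasigroup_closed : forall a b, S a -> S b -> S (op a b);
  quasigroup_ldiv : forall a b, S a -> S b -> exists! x, S x /\ op a x = b;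
  quasigroup_rdiv : forall a b, S a -> S b -> exists! y, S y /\ op y a = b
}.

Definition is_right_unit (T : Type) (S : set T) (op : T -> T -> T) (e : T) :
  Prop := S e /\ forall a, S a -> op a e = a.

(* Main.v *)
Require Import Defs.
From HB Require Import structures.
From mathcomp Require Import all_boot all_order all_algebra.
From mathcomp Require Import complex.
From mathcomp Require Import classical_sets reals.

(** Read as matrices, a cracovian product is B^T *m A, and the transposing
    cracovian is the identity matrix.  The equations A.X = B and Y.A = B thus
    become X^T *m A = B and A^T *m Y = B, which for invertible A have exactly
    one solution each, X = (B *m A^-1)^T and Y = (A^T)^-1 *m B.  A group of
    matrices stable under transposition contains the products and both of
    these quotients.  The unit is one-sided in general: A.T = A because the
    second factor is the one that gets transposed, whereas T.A = A^T. *)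

Set Implicit Arguments.
Unset Strict Implicit.
Unset Printing Implicit Defensive.

Import GRing.Theory.
Local Open Scope ring_scope.
Local Open Scope complex_scope.

Lemma cracmulE (R : realType) (q r p : nat)
    (A : cracovian R q p) (B : cracovian R r p) :
  cracmul A B = B^T *m A.
Proof.
apply/matrixP=> l k; rewrite !mxE.
by apply: eq_bigr => i _; rewrite mxE mulrC.
Qed.

Lemma cracT1 (R : realType) (n : nat) : cracT R n = 1%:M.
Proof. by apply/matrixP=> l k; rewrite !mxE eq_sym; case: eqP. Qed.

Lemma mulmx_eq_ldiv (K : comUnitRingType) (n m : nat)
    (A : 'M[K]_n) (Y B : 'M[K]_(n, m)) :
  A \in unitmx -> A *m Y = B <-> Y = invmx A *m B.
Proof. by move=> Au; split=> [<-|->]; rewrite ?mulKmx ?mulKVmx. Qed.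

Lemma trmx_mulmx_eq_rdiv (K : comUnitRingType) (n m : nat)
    (A : 'M[K]_n) (X : 'M[K]_(n, m)) (B : 'M[K]_(m, n)) :
  A \in unitmx -> X^T *m A = B <-> X = (B *m invmx A)^T.
Proof.
by move=> Au; split=> [<-|->]; rewrite ?mulmxK ?trmxK ?mulmxKV.
Qed.

Theorem corollary4p1 (R : realType) (n : nat) (hn : (0 < n)%N)
    (G : set 'M[R[i]]_n)
    (hG : is_matrix_group G)
    (hGT : forall A : 'M[R[i]]_n, G A -> G A^T) :
  is_quasigroup (G : set (cracovian R n n)) (@cracmul R n n n) /\
  is_right_unit (G : set (cracovian R n n)) (@cracmul R n n n) (cracT R n).
Proof.
case: hG => Gunit G1 GM GV.
split; split.
- by move=> A B GA GB; rewrite cracmulE; apply: GM => //; apply: hGT.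
- move=> A B GA GB; have Au := Gunit _ GA.
  exists (B *m invmx A)^T; split=> [|X [_]]; rewrite cracmulE.
    split; first by apply: hGT; apply: GM => //; apply: GV.
    exact/(trmx_mulmx_eq_rdiv _ _ Au).
  by move/(trmx_mulmx_eq_rdiv _ _ Au).
- move=> A B GA GB; have Au := Gunit _ (hGT _ GA).
  exists (invmx A^T *m B); split=> [|Y [_]]; rewrite cracmulE.
    split; first by apply: GM => //; apply: GV; apply: hGT.
    exact/(mulmx_eq_ldiv _ _ Au).
  by move/(mulmx_eq_ldiv _ _ Au).
- by rewrite cracT1.
- by move=> A _; rewrite cracmulE cracT1 trmx1 mul1mx.
Qed.
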